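(* Let $X$ be a real normed space, let $\sigma \ge 0$, and let $f\colon X \to \mathbb{R}$ be a continuously Fréchet differentiable function. Consider the following conditions: (a) The function $f$ is $\sigma$-quasiconvex. (b) For all $x,y \in X$, we have the implication $$f(x) \leq f(y) \ \Longrightarrow\ \langle\nabla f(y), x-y\rangle \leq -\frac{\sigma}{2}\|x-y\|^2.$$ (c) For all $x,y\in X$, we have the implication $$\langle\nabla f(x), y-x\rangle > -\frac{\sigma}{2}\|x-y\|^2 \ \Longrightarrow\ \langle\nabla f(y), x-y \rangle \leq -\frac{\sigma}{2}\|x-y\|^2.$$ Then (a) implies (b), and (b) implies (c).
   Context: $X^*$ denotes the topological dual of the real normed space $X$, and $\langle x^*, x\rangle = x^*(x)$ for $x^*\in X^*$, $x\in X$. For a Fréchet differentiable $f\colon X\to\mathbb{R}$, $\nabla f(x)\in X^*$ denotes the Fréchet derivative of $f$ at $x$; continuously Fréchet differentiable means that $x\mapsto\nabla f(x)$ is continuous from $X$ to $X^*$ with its norm topology. For $\sigma\ge 0$, a function $f\colon X\to\mathbb{R}$ is $\sigma$-quasiconvex if for all $x,y\in X$ and all $\lambda\in(0,1)$, $$f(\lambda x+(1-\lambda)y)\le \max\{f(x),f(y)\}-\frac{\sigma}{2}\lambda(1-\lambda)\|x-y\|^2.$$ *)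

(* Defs.v *)
From mathcomp Require Import all_boot all_order all_algebra.
From mathcomp Require Import all_classical all_reals all_analysis.
Set Implicit Arguments.
Unset Strict Implicit.
Unset Printing Implicit Defensive.
Import Order.TTheory GRing.Theory Num.Theory.
Import numFieldNormedType.Exports.
Local Open Scope classical_set_scope.
Local Open Scope ring_scope.

(* The set is bounded whenever l is linear and continuous, in particular for a
   difference of differentials at points of differentiability; for other l this
   may be the default value of [sup]. *)
Definition dual_norm (R : realType) (X : normedModType R) (l : X -> R) : R :=
  sup [set `|l h| | h in [set h : X | `|h| <= 1]].

(* The library has no normed space of continuous linear forms, so continuity of
   x |-> 'd f x into the normed dual is stated through [dual_norm]. *)
Definition continuously_differentiable (R : realType) (X : normedModType R)
    (f : X -> R) : Prop :=
  (forall x, differentiable f x) /\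
  (forall x, dual_norm (fun h => 'd f y h - 'd f x h) @[y --> x] --> (0 : R)).

Definition quasiconvex (R : realType) (X : normedModType R) (sigma : R)
    (f : X -> R) : Prop :=
  forall (x y : X) (t : R), 0 < t < 1 ->
    f (t *: x + (1 - t) *: y) <=
      Num.max (f x) (f y) - sigma / 2 * t * (1 - t) * `|x - y| ^+ 2.

Definition sublevel_gradient_condition (R : realType) (X : normedModType R)
    (sigma : R) (f : X -> R) : Prop :=
  forall x y : X, f x <= f y ->
    'd f y (x - y) <= - (sigma / 2) * `|x - y| ^+ 2.

Definition quasimonotone_gradient_condition (R : realType)
    (X : normedModType R) (sigma : R) (f : X -> R) : Prop :=
  forall x y : X, 'd f x (y - x) > - (sigma / 2) * `|x - y| ^+ 2 ->
    'd f y (x - y) <= - (sigma / 2) * `|x - y| ^+ 2.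

(* Main.v *)
(** Along the segment from [y] to [x], quasiconvexity bounds the difference
    quotient of [f] at [y] by [- (sigma / 2) * (1 - h) * `|x - y| ^+ 2]; letting
    [h] decrease to [0] gives (b). For (c), the contrapositive of (b) at the
    point [x] gives [f x < f y], and then (b) applies at [y]. *)
Require Import Defs.
From mathcomp Require Import all_boot all_order all_algebra.
From mathcomp Require Import all_classical all_reals all_analysis.
From mathcomp Require Import lra.
Import Order.TTheory GRing.Theory Num.Theory.
Import numFieldNormedType.Exports.
Local Open Scope classical_set_scope.
Local Open Scope ring_scope.

Lemma quasiconvex_sublevel_gradient (R : realType) (X : normedModType R)
    (sigma : R) (f : X -> R) :
  (forall x, differentiable f x) ->
  quasiconvex sigma f -> sublevel_gradient_condition sigma f.
Proof.
move=> df qf x y fxy; set c := - (sigma / 2) * `|x - y| ^+ 2.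
have quot_cvg : h^-1 *: (f (h *: (x - y) + y) - f y) @[h --> 0^'+]
    --> 'd f y (x - y).
  (* The derivative along [x - y] is a limit over all nonzero [h]; only its right-hand part is kept,
     since quasiconvexity speaks of [0 < h < 1]. *)
  rewrite -deriveE //; apply: cvg_dnbhs_at_right.
  exact: (diff_derivable (df y)).
have bound_cvg : (1 - h) * c @[h --> 0^'+] --> c.
  (* Writing the limit [c] as [(1 - 0) * c] lets the product and difference rules apply. *)
  rewrite -[X in _ --> X]mul1r -[in X in _ --> X](subr0 1).
  apply: cvgMl; apply: cvgB; first exact: cvg_cst.
  exact/cvg_at_right_filter/cvg_id.
apply: ler_cvg_to quot_cvg bound_cvg _; near=> h.
have h0 : 0 < h by near: h; exact: nbhs_right_gt.
have h1 : h < 1 by near: h; apply: nbhs_right_lt.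
have := qf x y h; rewrite h0 h1 => /(_ isT).
rewrite (max_idPr fxy).
have -> : h *: x + (1 - h) *: y = h *: (x - y) + y.
  by rewrite scalerBr scalerBl scale1r addrA addrAC.
(* Clearing the denominator [h > 0] turns the goal into [fh], whose error term is
   [h * (1 - h) * c]. *)
move=> fh; rewrite /GRing.scale /= mulrC ler_pdivrMr //.
by rewrite lerBlDl (le_trans fh) // /c; lra.
Unshelve. all: by end_near. Qed.

Lemma sublevel_quasimonotone_gradient (R : realType) (X : normedModType R)
    (sigma : R) (f : X -> R) :
  sublevel_gradient_condition sigma f ->
  quasimonotone_gradient_condition sigma f.
Proof.
move=> sf x y dfx; apply: (sf); rewrite leNgt; apply/negP => /ltW /sf.
(* Symmetry of the norm makes the bound at [x] the exact negation of [dfx]. *)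
by rewrite distrC leNgt dfx.
Qed.

Theorem theorem3p1 (R : realType) (X : normedModType R) (sigma : R)
    (sigma_ge0 : 0 <= sigma) (f : X -> R)
    (f_C1 : continuously_differentiable f) :
  (quasiconvex sigma f -> sublevel_gradient_condition sigma f) /\
  (sublevel_gradient_condition sigma f ->
   quasimonotone_gradient_condition sigma f).
Proof.
split; last exact: sublevel_quasimonotone_gradient.
exact: quasiconvex_sublevel_gradient f_C1.1.
Qed.
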